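(* Let $K$ be a field of characteristic zero and let $\sigma\in S_n$ be an involution ($\sigma^2=\mathrm{id}$). For every $f\in X_\sigma$ the coadjoint orbit $\Omega(f)\subset\mathfrak{n}^*$ is a complete intersection.
   Context: $N=\mathrm{UT}(n,K)$ is the group of lower triangular $n\times n$ matrices over $K$ with ones on the diagonal, and $\mathfrak{n}=\mathfrak{ut}(n,K)$ is its Lie algebra of strictly lower triangular matrices, with standard basis $y_{ij}$ ($1\le j<i\le n$, the matrix unit with $1$ in row $i$, column $j$). $N$ acts on the dual space $\mathfrak{n}^*$ by $(\mathrm{Ad}^*_g f)(x)=f(\mathrm{Ad}_g^{-1}x)$, where $\mathrm{Ad}_g x=gxg^{-1}$; $\Omega(f)$ is the orbit of $f$ under this (coadjoint) action. Orbits of a regular action of a unipotent group on an affine variety are closed, so $\Omega(f)$ is a closed subvariety of the affine space $\mathfrak{n}^*$. It is a complete intersection if its defining ideal in $K[\mathfrak{n}^*]$ (all polynomials vanishing on $\Omega(f)$) can be generated by $\dim\mathfrak{n}^*-\dim\Omega(f)$ elements. $\Delta^+=\{\varepsilon_j-\varepsilon_i : 1\le j<i\le n\}$ is the set of positive roots of $\mathfrak{gl}(n,K)$; for $\xi=\varepsilon_j-\varepsilon_i\in\Delta^+$ put $j(\xi)=j$, $i(\xi)=i$, $y_\xi=y_{ij}$, and let $r_\xi\in S_n$ be the transposition $(j,i)$. The involution decomposes uniquely as a product of commuting reflections $\sigma=r_1\cdots r_s$, $r_m=r_{\xi_m}$, $\xi_m\in\Delta^+$. Put $\mathcal{S}=\{\xi_1,\dots,\xi_s\}$.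 $X_\sigma\subset\mathfrak{n}^*$ is the set of all $f$ with $f(y_{\xi_m})\neq0$ for $1\le m\le s$ and $f(y_\gamma)=0$ for all $\gamma\in\Delta^+\setminus\mathcal{S}$. *)

(* Defs.v *)
From HB Require Import structures.
From mathcomp Require Import all_boot all_order all_algebra all_fingroup.
From mathcomp Require Import mpoly zify.

Set Implicit Arguments.
Unset Strict Implicit.
Unset Printing Implicit Defensive.

Import GRing.Theory.
Local Open Scope ring_scope.

(* The positive root eps_j - eps_i (j < i) is encoded as the pair (j, i). *)
Definition posroot (n : nat) := {p : 'I_n * 'I_n | (p.1 < p.2)%N}.

Definition jroot n (xi : posroot n) : 'I_n := (val xi).1.
Definition iroot n (xi : posroot n) : 'I_n := (val xi).2.

Lemma root_lt n (xi : posroot n) : (jroot xi < iroot xi)%N.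
Proof. exact: (valP xi). Qed.

Lemma root_eq n (xi eta : posroot n) :
  jroot xi = jroot eta -> iroot xi = iroot eta -> xi = eta.
Proof.
rewrite /jroot /iroot => ej ei; apply: val_inj.
by rewrite [LHS]surjective_pairing ej ei -surjective_pairing.
Qed.

Definition root_refl n (xi : posroot n) : 'S_n := tperm (jroot xi) (iroot xi).

Definition UT (K : fieldType) (n : nat) : pred 'M[K]_n :=
  [pred g | is_trig_mx g && [forall i, g i i == 1]].

Definition ymx (K : fieldType) n (xi : posroot n) : 'M[K]_n :=
  delta_mx (iroot xi) (jroot xi).

Definition ut (K : fieldType) (n : nat) : {vspace 'M[K]_n} :=
  <<[seq ymx K xi | xi : posroot n]>>%VS.

Lemma ymx_ut (K : fieldType) n (xi : posroot n) : ymx K xi \in ut K n.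
Proof. by apply: memv_span; apply: image_f. Qed.

Lemma mem_utP (K : fieldType) n (x : 'M[K]_n) :
  (forall i j : 'I_n, (i <= j)%N -> x i j = 0) <-> x \in ut K n.
Proof.
split=> [x0 | xut i j le_ij].
  rewrite (matrix_sum_delta x); apply: memv_suml => i _; apply: memv_suml => j _.
  have [/x0-> | lt_ji] := leqP i j; first by rewrite scale0r mem0v.
  exact: memvZ (ymx_ut K (exist _ (j, i) lt_ji)).
rewrite (coord_span (X := in_tuple _) xut) summxE big1 // => k _.
rewrite mxE; set v := _`_k.
have /imageP[xi _ ->] : v \in [seq ymx K xi | xi : posroot n].
  by apply: mem_nth; exact: ltn_ord.
rewrite mxE; case: eqP => [ei|]; last by rewrite mulr0.
case: eqP => [ej|]; last by rewrite mulr0.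
by have := root_lt xi; rewrite -ei -ej ltnNge le_ij.
Qed.

Definition ut_dual (K : fieldType) (n : nat) := 'Hom(subvs_of (ut K n), K^o).

Definition yvec (K : fieldType) n (xi : posroot n) : subvs_of (ut K n) :=
  vsproj (ut K n) (ymx K xi).

(* vsproj is a total projection 'M[K]_n -> ut K n, and linfun totalizes the
   construction of a linear map; val_Ad and coAdE show that neither has any
   effect here. *)
Definition Ad (K : fieldType) n (g : 'M[K]_n) (x : subvs_of (ut K n)) :
    subvs_of (ut K n) :=
  vsproj (ut K n) (g *m vsval x *m invmx g).

Definition coAd (K : fieldType) n (g : 'M[K]_n) (f : ut_dual K n) :
    ut_dual K n :=
  linfun (fun x => f (Ad (invmx g) x)).

Lemma UT_unit (K : fieldType) n (g : 'M[K]_n) : UT g -> g \in unitmx.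
Proof.
case/andP=> trg /forallP g1; rewrite unitmxE det_trig //.
by rewrite big1 ?unitr1 // => i _; exact/eqP.
Qed.

Lemma trig_mul_ut (K : fieldType) n (a x : 'M[K]_n) :
  is_trig_mx a -> x \in ut K n -> a *m x \in ut K n.
Proof.
move=> /is_trig_mxP tra /mem_utP x0; apply/mem_utP => i j le_ij.
rewrite mxE big1 // => k _; have [lt_ik | le_ki] := ltnP i k.
  by rewrite tra // mul0r.
by rewrite (x0 k) ?mulr0 // (leq_trans le_ki).
Qed.

Lemma ut_mul_trig (K : fieldType) n (x b : 'M[K]_n) :
  is_trig_mx b -> x \in ut K n -> x *m b \in ut K n.
Proof.
move=> /is_trig_mxP trb /mem_utP x0; apply/mem_utP => i j le_ij.
rewrite mxE big1 // => k _; have [lt_kj | le_jk] := ltnP k j.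
  by rewrite (trb k j) // mulr0.
by rewrite x0 ?mul0r // (leq_trans le_ij).
Qed.

Lemma UT_inv (K : fieldType) n (g : 'M[K]_n) : UT g -> UT (invmx g).
Proof.
move=> UTg; have gU := UT_unit UTg; case/andP: UTg => /is_trig_mxP trg /forallP g1.
have gV i j : (g *m invmx g) i j = (i == j)%:R by rewrite mulmxV // mxE.
have V0 m : forall i j : 'I_n, (i < m)%N -> (i < j)%N -> invmx g i j = 0.
  elim: m => // m IHm i j; rewrite ltnS => le_im lt_ij.
  have := gV i j; rewrite mxE (bigD1 i) //= (eqP (g1 i)) mul1r big1 ?addr0.
    by move=> ->; rewrite -val_eqE ltn_eqF.
  move=> k ne_ki; have [lt_ik | le_ki] := ltnP i k; first by rewrite trg ?mul0r.
  have lt_ki : (k < i)%N by rewrite ltn_neqAle le_ki andbT val_eqE.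
  rewrite IHm ?mulr0 //; first exact: leq_trans lt_ki _.
  exact: ltn_trans lt_ki _.
have trV (i j : 'I_n) : (i < j)%N -> invmx g i j = 0 by apply: (V0 i.+1).
apply/andP; split; first exact/is_trig_mxP.
apply/forallP => i; have := gV i i; rewrite mxE (bigD1 i) //= (eqP (g1 i)) mul1r.
rewrite big1 ?addr0 ?eqxx => [-> //|k ne_ki].
have [lt_ik | le_ki] := ltnP i k; first by rewrite trg ?mul0r.
by rewrite trV ?mulr0 // ltn_neqAle le_ki andbT val_eqE.
Qed.

Lemma val_Ad (K : fieldType) n (g : 'M[K]_n) (x : subvs_of (ut K n)) :
  UT g -> vsval (Ad g x) = g *m vsval x *m invmx g.
Proof.
move=> UTg; rewrite /Ad vsprojK // ut_mul_trig //.
  by have /andP[] := UT_inv UTg.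
by apply: trig_mul_ut (subvsP x); have /andP[] := UTg.
Qed.

Lemma coAdE (K : fieldType) n (g : 'M[K]_n) (f : ut_dual K n) x :
  coAd g f x = f (Ad (invmx g) x).
Proof.
pose h := fun x => f (Ad (invmx g) x).
have linh : linear h.
  move=> a u v; rewrite /h -linearP /Ad; congr (f _).
  by rewrite -linearP (linearP vsval) mulmxDr mulmxDl -scalemxAr -scalemxAl.
pose hM := GRing.isLinear.Build K _ K^o _ h linh.
pose hL : {linear _ -> K^o} := HB.pack h hM.
exact: (lfunE hL).
Qed.

Definition coAd_orbit (K : fieldType) n (f h : ut_dual K n) : Prop :=
  exists2 g : 'M[K]_n, UT g & h = coAd g f.

(* The k-th variable of the polynomial ring K[n^*] is the coordinate function
   h |-> h(y_xi), where xi is the k-th positive root. *)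
Definition poly_dual (K : fieldType) n := {mpoly K[#|{: posroot n}|]}.

Definition eval_dual (K : fieldType) n (p : poly_dual K n) (h : ut_dual K n) :
    K :=
  p.@[fun k => h (yvec K (enum_val k))].

Section Varieties.
Variables (K : fieldType) (n : nat).
Implicit Types (Z : ut_dual K n -> Prop) (p : poly_dual K n).

Definition vanishing_ideal Z p : Prop := forall h, Z h -> eval_dual p h = 0.

Definition Zariski_closed Z : Prop :=
  forall h, (forall p, vanishing_ideal Z p -> eval_dual p h = 0) -> Z h.

Definition generates r (g : 'I_r -> poly_dual K n)
    (I : poly_dual K n -> Prop) : Prop :=
  forall p, I p <-> exists c : 'I_r -> poly_dual K n, p = \sum_(i < r) c i * g i.

(* The restrictions to Z of the polynomials q_i are algebraically independent
   elements of K[n^*] / vanishing_ideal Z. *)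
Definition alg_indep_on Z d (q : d.-tuple (poly_dual K n)) : Prop :=
  forall P : {mpoly K[d]}, vanishing_ideal Z (P \mPo q) -> P = 0.

(* The dimension of an affine variety is the maximal number of algebraically
   independent elements of its coordinate ring, i.e. the transcendence degree
   of its function field when it is irreducible. *)
Definition has_dim Z d : Prop :=
  (exists q : d.-tuple (poly_dual K n), alg_indep_on Z q) /\
  (forall e (q : e.-tuple (poly_dual K n)), alg_indep_on Z q -> (e <= d)%N).

Definition complete_intersection Z : Prop :=
  Zariski_closed Z /\
  exists d r, [/\ has_dim Z d, (r + d)%N = \dim {: ut_dual K n} &
    exists g : 'I_r -> poly_dual K n, generates g (vanishing_ideal Z)].

End Varieties.

Definition refl_decomposition n (sigma : 'S_n) (S : {set posroot n}) : Prop :=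
  {in S &, forall xi eta, commute (root_refl xi) (root_refl eta)} /\
  sigma = (\prod_(xi in S) root_refl xi)%g.

Lemma root_refl_disjoint n (xi eta : posroot n) :
  commute (root_refl xi) (root_refl eta) -> xi != eta ->
  [/\ jroot xi != jroot eta, jroot xi != iroot eta,
      iroot xi != jroot eta & iroot xi != iroot eta].
Proof.
move=> com ne.
have ne1 : ~~ ((jroot xi == jroot eta) && (iroot xi == iroot eta)).
  by apply: contra ne => /andP[/eqP ej /eqP ei]; apply/eqP/root_eq.
have := congr1 (fun s : 'S_n => s (jroot xi)) com.
have := congr1 (fun s : 'S_n => s (iroot xi)) com.
have := root_lt xi; have := root_lt eta; move: ne1 {com ne}.
rewrite !permM /root_refl tpermL tpermR.
move: (jroot xi) (iroot xi) (jroot eta) (iroot eta) => a b c d.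
rewrite -!val_eqE => ne1 cd ab.
have valtp (x y z : 'I_n) : val (tperm x y z) =
    if val z == val x then val y else if val z == val y then val x else val z.
  by rewrite permE /= -!val_eqE /=; case: ifP => // _; case: ifP.
move=> /(congr1 val) + /(congr1 val); rewrite !valtp.
case: a b c d ne1 cd ab => [a ?] [b ?] [c ?] [d ?] /= ne1 cd ab.
by do !case: eqP => ?; move=> ? ?; split; lia.
Qed.

Lemma refl_prodE n (s : seq (posroot n)) :
  uniq s -> {in s &, forall xi eta, commute (root_refl xi) (root_refl eta)} ->
  (forall xi, xi \in s ->
     (\prod_(eta <- s) root_refl eta)%g (jroot xi) = iroot xi /\
     (\prod_(eta <- s) root_refl eta)%g (iroot xi) = jroot xi) /\
  (forall x, (forall xi, xi \in s -> (x != jroot xi) && (x != iroot xi)) ->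
     (\prod_(eta <- s) root_refl eta)%g x = x).
Proof.
elim: s => [|rho s IHs] /=; first by split=> // x _; rewrite big_nil perm1.
case/andP=> rho_s uniq_s com.
have [|IH1 IH2] := IHs uniq_s.
  by move=> xi eta xis etas; apply: com; rewrite inE ?xis ?etas orbT.
have disj xi : xi \in s -> [/\ jroot rho != jroot xi, jroot rho != iroot xi,
    iroot rho != jroot xi & iroot rho != iroot xi].
  move=> xis; apply: root_refl_disjoint; last by apply: contraNneq rho_s => ->.
  by apply: com; rewrite inE ?eqxx ?xis ?orbT.
split=> [xi | x xP]; rewrite big_cons !permM.
  rewrite inE => /predU1P[-> | xis].
    rewrite /root_refl tpermL tpermR.
    by split; apply: IH2 => eta /disj[? ? ? ?]; apply/andP.
  by have [? ? ? ?] := disj xi xis; rewrite !tpermD //; apply: IH1.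
have /andP[? ?] := xP rho (mem_head _ _).
rewrite tpermD 1?eq_sym // IH2 // => xi xis.
by apply: xP; rewrite inE xis orbT.
Qed.

Lemma refl_decompositionE n (sigma : 'S_n) (S : {set posroot n}) :
  refl_decomposition sigma S -> S = [set xi | sigma (jroot xi) == iroot xi].
Proof.
case=> com; rewrite -big_filter; set e := filter _ _ => def_sigma.
have mem_e xi : (xi \in e) = (xi \in S) by rewrite mem_filter mem_index_enum andbT.
have [| |in_s notin_s] := @refl_prodE n e.
- exact: filter_uniq (index_enum_uniq _).
- by move=> xi eta; rewrite !mem_e; apply: com.
rewrite -def_sigma in in_s notin_s.
apply/setP => xi; rewrite inE; apply/idP/eqP => [xiS | sxi].
  by have [] := in_s xi; rewrite ?mem_e.
have lt_xi := root_lt xi.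
have [/existsP[eta /andP[etaS /orP[]]] | /existsPn none] :=
  boolP [exists eta, (eta \in S) &&
    ((jroot xi == jroot eta) || (jroot xi == iroot eta))].
- have [|sj _] := in_s eta; rewrite ?mem_e // => /eqP ej.
  by rewrite (@root_eq _ xi eta) // -sxi ej.
- have [|_ si] := in_s eta; rewrite ?mem_e // => /eqP ej.
  have lt_eta := root_lt eta.
  by move: lt_xi; rewrite -sxi ej si ltnNge ltnW.
move: lt_xi; rewrite -sxi notin_s ?ltnn // => eta; rewrite mem_e => etaS.
by have := none eta; rewrite etaS negb_or.
Qed.

Lemma refl_decomposition_exists n (sigma : 'S_n) :
  (sigma * sigma = 1)%g -> exists S, refl_decomposition sigma S.
Proof.
move=> sigma2; have sK x : sigma (sigma x) = x by rewrite -permM sigma2 perm1.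
pose S := [set xi | sigma (jroot xi) == iroot xi]; exists S.
have com : {in S &, forall xi eta, commute (root_refl xi) (root_refl eta)}.
  move=> xi eta; rewrite !inE => /eqP sxi /eqP seta.
  have [-> //|ne] := eqVneq xi eta.
  have sxi' : sigma (iroot xi) = jroot xi by rewrite -sxi sK.
  have seta' : sigma (iroot eta) = jroot eta by rewrite -seta sK.
  have lxi := root_lt xi; have leta := root_lt eta.
  have nej : jroot eta != jroot xi.
    by apply: contra ne => /eqP e; apply/eqP/root_eq; rewrite // -sxi -seta e.
  have nei : iroot eta != iroot xi.
    by apply: contra nej => /eqP e; rewrite -seta' -sxi' e.
  have nji : jroot eta != iroot xi.
    apply/eqP => e; move: leta; rewrite -seta e sxi' => lt2.
    by have := ltn_trans lxi lt2; rewrite ltnn.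
  have nij : iroot eta != jroot xi.
    apply/eqP => e; move: lxi; rewrite -sxi -e seta' => lt2.
    by have := ltn_trans leta lt2; rewrite ltnn.
  by rewrite /commute conjgC /root_refl tpermJ !tpermD.
split=> //; rewrite -big_filter; set e := filter _ _.
have mem_e xi : (xi \in e) = (xi \in S) by rewrite mem_filter mem_index_enum andbT.
have [| |in_s notin_s] := @refl_prodE n e.
- exact: filter_uniq (index_enum_uniq _).
- by move=> xi eta; rewrite !mem_e; apply: com.
apply/permP => x; case: (ltngtP x (sigma x)) => [lt|lt|/val_inj fix_x].
- pose xi : posroot n := exist _ (x, sigma x) lt.
  have [|sj _] := in_s xi; first by rewrite mem_e inE eqxx.
  exact/esym/sj.
- pose xi : posroot n := exist _ (sigma x, x) lt.
  have [|_ si] := in_s xi; first by rewrite mem_e inE sK eqxx.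
  exact/esym/si.
rewrite -fix_x notin_s // => eta; rewrite mem_e inE => /eqP seta.
have := root_lt eta; rewrite -seta => leta.
apply/andP; split; apply: contraTneq leta => ex.
  by rewrite -ex -fix_x ltnn.
by rewrite -ex fix_x ex sK ltnn.
Qed.

Definition X (K : fieldType) n (sigma : 'S_n) (f : ut_dual K n) : Prop :=
  exists S : {set posroot n}, [/\ refl_decomposition sigma S,
    forall xi, xi \in S -> f (yvec K xi) != 0 &
    forall gamma, gamma \notin S -> f (yvec K gamma) = 0].

(* Main.v *)
Require Import Defs.
From mathcomp Require Import all_boot all_order all_algebra all_fingroup.
From mathcomp Require Import mpoly zify ring.
From Stdlib Require Import Classical.

(** The orbit is the graph of a polynomial map from some of the coordinates of
    n^* to the remaining ones, and a graph is a complete intersection.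

    Why the orbit is a graph.  Order the roots, seen as intervals from j to i, by
    inclusion ([root_le]); the matrix unit of a larger root lies further from the
    diagonal.
    The matrix units of an up-closed set D of roots span an ideal of n which the
    conjugations preserve, so the group acts on the restrictions of linear forms
    to D.  The orbit is described by adding the roots to D one at a time.  Let xi
    be the new root.  The elements g fixing f on D translate the coordinate xi of
    f, and the amount of the translation is the value on g of the linear function
    a |-> f(y_xi a - a y_xi) ([coAd_comm_form]).  It vanishes on the identity, so
    there are two cases.  If it vanishes on the whole stabilizer, the coordinate
    xi of a point of the orbit is determined by the coordinates in D.  Otherwise
    the stabilizer, which contains the line through 1 and any of its elements
    ([stabilizer_line]), translates this coordinate arbitrarily, with an amount
    which is a linear parameter of a line of group elements; then xi is a free
    coordinate.  Either way a section of the orbit map persists, a matrix s of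
    polynomials such that s(a) f is the point of the orbit whose free coordinates
    are those of a ([orbit_section]).

    Why this gives a complete intersection.  Let S be the set of free roots and
    rho(a) = s(a) f, a polynomial retraction of the affine space onto the orbit
    which leaves the coordinates in S unchanged and depends on these
    coordinates only.  A polynomial p vanishing on the orbit satisfies p o rho = 0, because K is infinite, and p - p o rho lies in the
    ideal generated by the x_xi - rho_xi, which vanish on the orbit, and which
    are zero for xi in S.  This leaves as many generators as there are roots
    outside S.  The dimension is the cardinal of S: the coordinates in S are
    independent on the orbit, and all others are polynomials in them, so that
    more than #|S| functions are dependent ([mpoly_alg_dependent]). *)

Set Implicit Arguments.
Unset Strict Implicit.
Unset Printing Implicit Defensive.

Import GRing.Theory.
Local Open Scope ring_scope.

(** * Polynomials over a field of characteristic zero *)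

Lemma poly_eq0_char0 (K : fieldType) (p : {poly K}) :
  [pchar K] =i pred0 -> (forall t, p.[t] = 0) -> p = 0.
Proof.
move=> charK0 p0; apply/eqP; apply: contraT => nz_p.
have natrI : injective (fun i : nat => i%:R : K).
  move=> i j; wlog le_ij : i j / (i <= j)%N.
    by move=> W; case: (leqP i j) => [/W|/ltnW/W] // + e; move/(_ (esym e)) ->.
  move=> /eqP; rewrite eq_sym -subr_eq0 -natrB // (pcharf0P K).1 // subn_eq0 => le_ji.
  by apply/eqP; rewrite eqn_leq le_ij.
have := max_poly_roots (rs := [seq i%:R | i <- iota 0 (size p)]) nz_p.
rewrite map_inj_uniq ?iota_uniq // size_map size_iota ltnn => -> //.
by apply/allP => _ /mapP[i _ ->]; rewrite /root p0.
Qed.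

(** Uniqueness of the digits in base D. *)
Lemma digits_inj D n (m1 m2 : 'I_n -> nat) :
  (forall i, (m1 i < D)%N) -> (forall i, (m2 i < D)%N) ->
  (\sum_i m1 i * D ^ i = \sum_i m2 i * D ^ i)%N -> m1 =1 m2.
Proof.
elim: n m1 m2 => [|n IHn] m1 m2 m1D m2D; first by move=> _ [].
rewrite !big_ord_recl /= expn0 !muln1.
have shift (m : 'I_n.+1 -> nat) :
    (\sum_(i < n) m (lift ord0 i) * D ^ bump 0 i
       = (\sum_(i < n) m (lift ord0 i) * D ^ i) * D)%N.
  by rewrite big_distrl; apply: eq_bigr => i _; rewrite /bump add1n expnSr mulnA.
rewrite !shift => e.
have e0 : m1 ord0 = m2 ord0.
  by have /(congr1 (modn^~ D)) := e; rewrite ![(_ ord0 + _)%N]addnC !modnMDl !modn_small.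
move/eqP: e; rewrite e0 eqn_add2l eqn_pmul2r; last exact: leq_ltn_trans (m1D ord0).
move=> /eqP/IHn e i; have [j ->|->] := unliftP ord0 i; last exact: e0.
exact: e.
Qed.

(** Kronecker's substitution of t^(D^i) for the i-th variable, with D larger than
    all exponents, sends distinct monomials of p to distinct powers of t, and so
    reduces the claim to one variable. *)
Lemma mpoly_eq0_char0 (K : fieldType) n (p : {mpoly K[n]}) :
  [pchar K] =i pred0 -> (forall a, p.@[a] = 0) -> p = 0.
Proof.
move=> charK0 p0; pose D := msize p.
have code_inj : {in msupp p &, injective (fun m : 'X_{1..n} => \sum_i m i * D ^ i)%N}.
  move=> m1 m2 m1p m2p e; apply/mnmP; apply: digits_inj e => i.
    by apply: leq_ltn_trans (msize_mdeg_lt m1p); rewrite mdegE (bigD1 i) //= leq_addr.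
  by apply: leq_ltn_trans (msize_mdeg_lt m2p); rewrite mdegE (bigD1 i) //= leq_addr.
pose P : {poly K} := \sum_(m <- msupp p) p@_m *: 'X^(\sum_i m i * D ^ i).
have P0 : P = 0.
  apply: poly_eq0_char0 => // t; rewrite -[RHS](p0 (fun i => t ^+ (D ^ i))).
  rewrite mevalE horner_sum; apply: eq_bigr => m _; rewrite hornerZ hornerXn.
  congr (_ * _); rewrite expr_sum; apply: eq_bigr => i _.
  by rewrite -exprM mulnC.
apply/mpolyP => m; rewrite mcoeff0; have [mp|] := boolP (m \in msupp p); last first.
  exact: memN_msupp_eq0.
have := congr1 (fun q : {poly K} => q`_(\sum_i m i * D ^ i)) P0.
rewrite coef0 coef_sum (bigD1_seq m) ?msupp_uniq //= coefZ coefXn eqxx mulr1.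
rewrite big1_seq ?addr0 // => m' /andP[ne m'p]; rewrite coefZ coefXn.
case: eqP => [e|]; last by rewrite mulr0.
by rewrite (code_inj m' m) ?eqxx // in ne.
Qed.

(** * Algebraic dependence *)

Lemma msize_prod_exp (K : fieldType) e d (q : 'I_e -> {mpoly K[d]}) b
    (m : 'I_e -> nat) :
  (forall l, (msize (q l) <= b.+1)%N) ->
  (msize (\prod_l q l ^+ m l) <= (\sum_l m l * b).+1)%N.
Proof.
move=> qb.
have msizeM2 (p r : {mpoly K[d]}) u v : (msize p <= u.+1)%N -> (msize r <= v.+1)%N ->
    (msize (p * r) <= (u + v).+1)%N.
  have [->|nzp] := eqVneq p 0; first by rewrite mul0r msize0.
  have [->|nzr] := eqVneq r 0; first by rewrite mulr0 msize0.
  rewrite msizeM // => pu rv; have := leq_add pu rv; rewrite addnS addSn.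
  by case: (_ + _)%N.
elim/big_ind2: _ => [|u p v r pu rv|l _]; first by rewrite msize1.
  exact: msizeM2.
elim: (m l) => [|k IHk]; first by rewrite expr0 msize1.
by rewrite exprS mulSn; apply: msizeM2.
Qed.

(** Counting for [mpoly_alg_dependent]: there are D^e monomials in e variables
    with exponents below D, more than the monomials in d variables available for
    their values, whose exponents grow only linearly with D. *)
Lemma exists_box_gt d e b : (d < e)%N ->
  exists D, ((D * b).+1 ^ d < D ^ e)%N.
Proof.
move=> lt_de; pose D := (b.+1 ^ d).+1; exists D.
apply: (@leq_ltn_trans ((D * b.+1) ^ d)).
  by case: d @D lt_de => // d D _; rewrite leq_exp2r // mulnS -add1n leq_add.
rewrite expnMn; apply: (@leq_trans (D ^ d.+1)); last exact: leq_pexp2l.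
by rewrite expnSr ltn_pmul2l // expn_gt0.
Qed.

(** A linear relation between the products of powers of the q_l is a polynomial
    relation between the q_l; one exists as soon as these products outnumber the
    monomials that can occur in them. *)
Lemma mpoly_alg_dependent (K : fieldType) d e (q : e.-tuple {mpoly K[d]}) :
  (d < e)%N -> exists2 P : {mpoly K[e]}, P != 0 & P \mPo q = 0.
Proof.
move=> lt_de; pose b := \max_l msize (tnth q l).
have [D ltD] := exists_box_gt (e * b) lt_de.
pose M := (D * (e * b)).+1.
pose mon k B (i : {ffun 'I_k -> 'I_B}) : 'X_{1..k} := [multinom (i l : nat) | l < k].
pose R := {ffun 'I_e -> 'I_D}; pose C := {ffun 'I_d -> 'I_M}.
pose A := \matrix_(i < #|{: R}|, j < #|{: C}|)
  ('X_[mon _ _ (enum_val i)] \mPo q)@_(mon _ _ (enum_val j)).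
have : kermx A != 0.
  (* [A] has more rows than columns. *)
  rewrite kermx_eq0; apply: contraTN (rank_leq_col A) => /eqP ->.
  by rewrite -ltnNge !card_ffun !card_ord.
case/rowV0Pn=> v /sub_kermxP vA0 nz_v.
pose P : {mpoly K[e]} := \sum_i v 0 i *: 'X_[mon _ _ (enum_val i)].
have mon_inj k B : injective (mon k B).
  move=> i1 i2 /mnmP eqi; apply/ffunP => l; apply: val_inj.
  by have := eqi l; rewrite !mnmE.
exists P.
  apply: contraNneq nz_v => P0; apply/eqP/rowP => i; rewrite mxE.
  have := congr1 (mcoeff (mon _ _ (enum_val i))) P0.
  rewrite mcoeff0 raddf_sum (bigD1 i) //= mcoeffZ mcoeffX eqxx mulr1 big1 ?addr0 //.
  move=> j ne_ji; rewrite mcoeffZ mcoeffX.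
  case: eqP => [/mon_inj/enum_val_inj e_ji|]; last by rewrite mulr0.
  by rewrite e_ji eqxx in ne_ji.
have -> : P \mPo q = \sum_i v 0 i *: ('X_[mon _ _ (enum_val i)] \mPo q).
  by rewrite [LHS](raddf_sum (comp_mpoly q)); apply: eq_bigr => i _; exact: comp_mpolyZ.
apply/mpolyP => m; rewrite mcoeff0 raddf_sum /=.
have [mM | /forallPn[l]] := boolP [forall l, (m l < M)%N].
  pose j : C := [ffun l => Ordinal (forallP mM l)].
  have -> : m = mon _ _ (enum_val (enum_rank j)).
    by apply/mnmP => l; rewrite enum_rankK mnmE ffunE.
  have := congr1 (fun B : 'rV_#|{: C}| => B 0 (enum_rank j)) vA0; rewrite !mxE => e0.
  by rewrite -[RHS]e0; apply: eq_bigr => i _; rewrite mcoeffZ mxE.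
rewrite -leqNgt => le_Mml; apply: big1 => i _; rewrite mcoeffZ.
rewrite memN_msupp_eq0 ?mulr0 //; apply: msize_mdeg_ge.
apply: (@leq_trans (m l)); last by rewrite mdegE (bigD1 l) //= leq_addr.
apply: leq_trans le_Mml; rewrite comp_mpolyX.
apply: leq_trans (msize_prod_exp (b := b) _ _) _.
  by move=> k; apply: leqW; apply: leq_bigmax.
rewrite ltnS mulnCA -[X in (_ <= X * _)%N]card_ord -sum_nat_const.
apply: leq_sum => k _.
by rewrite mnmE leq_mul2r ltnW ?orbT.
Qed.

(** * Coordinates on the dual of ut *)

Lemma yvecE (K : fieldType) n (xi : posroot n) : vsval (yvec K xi) = ymx K xi.
Proof. by rewrite vsprojK // ymx_ut. Qed.

Lemma ymxE (K : fieldType) n (xi eta : posroot n) :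
  ymx K xi (iroot eta) (jroot eta) = (eta == xi)%:R.
Proof.
rewrite mxE; congr (nat_of_bool _)%:R; apply/andP/eqP => [[/eqP ei /eqP ej]|->] //.
exact: root_eq.
Qed.

Lemma ut_sum_ymx (K : fieldType) n (x : 'M[K]_n) : x \in ut K n ->
  x = \sum_(xi : posroot n) x (iroot xi) (jroot xi) *: ymx K xi.
Proof.
move=> /mem_utP x0; apply/matrixP => i j; rewrite summxE.
have [le_ij | lt_ji] := leqP i j.
  rewrite x0 // big1 // => xi _; rewrite !mxE.
  case: eqP => [ei|_]; last by rewrite mulr0.
  case: eqP => [ej|_]; last by rewrite mulr0.
  by move: (root_lt xi) le_ij; rewrite ei ej ltnNge => /negbTE ->.
pose xi : posroot n := exist _ (j, i) lt_ji.
rewrite (bigD1 xi) //= mxE (ymxE K xi xi) eqxx mulr1 big1 ?addr0 // => eta ne.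
by rewrite mxE (ymxE K eta xi) eq_sym (negbTE ne) mulr0.
Qed.

Lemma ut_dualE (K : fieldType) n (h : ut_dual K n) x : x \in ut K n ->
  h (vsproj (ut K n) x) = \sum_xi x (iroot xi) (jroot xi) * h (yvec K xi).
Proof.
move=> xut; rewrite {1}(ut_sum_ymx xut) !linear_sum; apply: eq_bigr => xi _.
by rewrite !linearZ.
Qed.

Lemma ut_dual_eq (K : fieldType) n (h1 h2 : ut_dual K n) :
  (forall xi, h1 (yvec K xi) = h2 (yvec K xi)) -> h1 = h2.
Proof.
move=> eqh; apply/lfunP => x; rewrite -[x]vsvalK !ut_dualE ?subvsP //.
by apply: eq_bigr => xi _; rewrite eqh.
Qed.

Lemma dim_ut_dual (K : fieldType) n : \dim {: ut_dual K n} = #|{: posroot n}|.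
Proof.
rewrite dimvf (_ : dim _ = (\dim (ut K n) * 1)%N); last by [].
rewrite muln1 /ut.
have /eqP -> : free [seq ymx K xi | xi : posroot n]; last by rewrite size_image.
apply/(@freeP _ _ _ (in_tuple _)) => k sum0 i.
have lt_i : (i < #|{: posroot n}|)%N by rewrite -(size_image (@ymx K n)).
pose xi := enum_val (Ordinal lt_i).
have nth_ymx (l : 'I_(size [seq ymx K xi | xi : posroot n]))
    (lt_l : (l < #|{: posroot n}|)%N) :
  (in_tuple [seq ymx K xi | xi : posroot n])`_l = ymx K (enum_val (Ordinal lt_l)).
  by rewrite /= (nth_image _ _ (Ordinal lt_l)).
have := congr1 (fun A : 'M[K]_n => A (iroot xi) (jroot xi)) sum0.
rewrite summxE mxE (bigD1 i) //= (nth_ymx i lt_i) mxE ymxE eqxx mulr1 big1 ?addr0 //.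
move=> l ne_li; have lt_l : (l < #|{: posroot n}|)%N by rewrite -(size_image (@ymx K n)).
rewrite (nth_ymx l lt_l) mxE ymxE; case: eqP; last by rewrite mulr0.
by move/enum_val_inj/(congr1 val) => /= e; rewrite -val_eqE /= e eqxx in ne_li.
Qed.

(** * Polynomial retracts *)

(** Substitution of rho is a ring morphism that agrees with the identity modulo
    the differences of the variables with their images, hence everywhere. *)
Lemma comp_mpoly_sub_ideal (K : fieldType) n (rho : n.-tuple {mpoly K[n]}) p :
  exists c : 'I_n -> {mpoly K[n]},
    p - (p \mPo rho) = \sum_k c k * ('X_k - tnth rho k).
Proof.
pose I p := exists c : 'I_n -> {mpoly K[n]},
  p - (p \mPo rho) = \sum_k c k * ('X_k - tnth rho k).
have I1 c : I c%:MP.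
  by exists (fun=> 0); rewrite comp_mpolyC subrr big1 // => k _; rewrite mul0r.
have IX k : I 'X_k.
  exists (fun l => (l == k)%:R); rewrite comp_mpolyXU -tnth_nth (bigD1 k) //= eqxx mul1r.
  by rewrite big1 ?addr0 // => l /negbTE ->; rewrite mul0r.
have IM u v : I u -> I v -> I (u * v).
  case=> cu eu [cv ev]; exists (fun k => v * cu k + (u \mPo rho) * cv k).
  under eq_bigr do rewrite mulrDl -!mulrA.
  by rewrite big_split -!mulr_sumr -eu -ev rmorphM /=; ring.
have ID u v : I u -> I v -> I (u + v).
  case=> cu eu [cv ev]; exists (fun k => cu k + cv k).
  under eq_bigr do rewrite mulrDl.
  by rewrite big_split -eu -ev rmorphD /=; ring.
rewrite -/(I p); elim/mpolyind: p => [|a m p _ _ Ip]; first exact: (I1 0).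
apply: (ID) => //; rewrite -mul_mpolyC; apply: (IM) => //.
rewrite mpolyXE_id; elim/big_ind: _ => [||k _]; [exact: (I1 1) | exact: (IM) |].
by elim: (m k) => [|e IHe]; rewrite ?expr0 ?exprS; [exact: (I1 1)|exact: IM].
Qed.

(** The first hypothesis says that rho maps the affine space to Z, the second that
    it keeps the coordinates in S; by the third, a point of Z is recovered from
    these coordinates by rho, so Z is the graph of a polynomial map of them. *)
Lemma retract_complete_intersection (K : fieldType) n (Z : ut_dual K n -> Prop)
    (S : {set posroot n}) (rho : posroot n -> poly_dual K n) :
  [pchar K] =i pred0 ->
  (forall a, exists2 h, Z h & forall xi, h (yvec K xi) = (rho xi).@[a]) ->
  (forall xi, xi \in S -> forall a, (rho xi).@[a] = a (enum_rank xi)) ->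
  (forall h (a : 'I_#|{: posroot n}| -> K), Z h ->
     (forall xi, xi \in S -> h (yvec K xi) = a (enum_rank xi)) ->
     forall xi, h (yvec K xi) = (rho xi).@[a]) ->
  complete_intersection Z.
Proof.
move=> charK0 rhoZ rhoS Zrho.
pose pt (h : ut_dual K n) (k : 'I_#|{: posroot n}|) : K := h (yvec K (enum_val k)).
have ptE (h : ut_dual K n) xi : pt h (enum_rank xi) = h (yvec K xi).
  by rewrite /pt enum_rankK.
pose rt := [tuple rho (enum_val k) | k < #|{: posroot n}|].
have eval_rt p a : exists2 h, Z h & (p \mPo rt).@[a] = eval_dual p h.
  have [h Zh hE] := rhoZ a; exists h => //; rewrite comp_mpoly_meval.
  by apply: meval_eq => k; rewrite hE tnth_mktuple.
(* [lift b] has coordinates b on S and zero elsewhere; the sum has at most one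
   term. *)
pose lift b (k : 'I_#|{: posroot n}|) : K := \sum_(i < #|S| | enum_val i == enum_val k) b i.
have liftS b (i : 'I_#|S|) : lift b (enum_rank (enum_val i)) = b i.
  rewrite /lift enum_rankK (bigD1 i) //= big1 ?addr0 // => j /andP[/eqP e].
  by rewrite (enum_val_inj e) eqxx.
have vanish_rt p : vanishing_ideal Z p -> p \mPo rt = 0.
  move=> Zp; apply: mpoly_eq0_char0 => // a; have [h Zh ->] := eval_rt p a.
  exact: Zp.
have vanish_gen xi : vanishing_ideal Z ('X_(enum_rank xi) - rho xi).
  by move=> h Zh; rewrite /eval_dual mevalB mevalXU enum_rankK (Zrho h (pt h)) ?subrr.
split=> [h hZ|].
  have [h' Zh' h'E] := rhoZ (pt h); suff -> : h = h' by [].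
  apply: ut_dual_eq => xi; apply/eqP; rewrite h'E -subr_eq0; apply/eqP.
  by have := hZ _ (vanish_gen xi); rewrite /eval_dual mevalB mevalXU enum_rankK.
exists #|S|, #|~: S|; split.
- split=> [|e q q_indep].
    exists [tuple 'X_(enum_rank (enum_val i)) | i < #|S|] => P ZP.
    apply: mpoly_eq0_char0 => // b; have [h Zh hE] := rhoZ (lift b).
    rewrite -[RHS](ZP h Zh) /eval_dual comp_mpoly_meval; apply: meval_eq => i.
    by rewrite tnth_mktuple mevalXU enum_rankK hE rhoS ?liftS // enum_valP.
  rewrite leqNgt; apply/negP => lt_de.
  (* In terms of the free coordinates, the q_l are e polynomials in #|S|
     variables. *)
  pose it := [tuple (\sum_(i < #|S| | enum_val i == enum_val k) 'X_i : {mpoly K[#|S|]})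
             | k < #|{: posroot n}|].
  have it_eval b k : (tnth it k).@[b] = lift b k.
    by rewrite tnth_mktuple raddf_sum; apply: eq_bigr => i _; apply: mevalXU.
  have [P nzP Pq0] := mpoly_alg_dependent [tuple (tnth q l \mPo rt) \mPo it | l < e] lt_de.
  case/eqP: nzP; apply: q_indep => h Zh.
  pose b (i : 'I_#|S|) : K := h (yvec K (enum_val i)).
  have := congr1 (meval b) Pq0; rewrite comp_mpoly_meval meval0 => <-.
  rewrite /eval_dual comp_mpoly_meval; apply: meval_eq => l.
  rewrite tnth_mktuple !comp_mpoly_meval; apply: meval_eq => k.
  rewrite tnth_mktuple; under [RHS]meval_eq do rewrite it_eval.
  apply: Zrho => // xi xiS; have -> : xi = enum_val (enum_rank_in xiS xi).
    by rewrite enum_rankK_in.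
  by rewrite liftS.
- by rewrite addnC cardsC dim_ut_dual.
exists (fun i => 'X_(enum_rank (enum_val i)) - rho (enum_val i)) => p.
split=> [Zp | [c ->] h Zh]; last first.
  rewrite /eval_dual raddf_sum big1 // => i _ /=; rewrite mevalM.
  by rewrite [X in _ * X](vanish_gen _ h Zh) mulr0.
have [c def_p] := comp_mpoly_sub_ideal rt p.
exists (fun i => c (enum_rank (enum_val i))).
rewrite -[LHS]subr0 -[X in _ - X](vanish_rt p Zp) def_p.
rewrite (reindex enum_rank) /=; last first.
  by exists enum_val => xi _; rewrite ?enum_rankK ?enum_valK.
rewrite (bigID (mem S)) /= big1 ?add0r => [|xi xiS]; last first.
  rewrite (_ : _ - _ = 0) ?mulr0 //; apply: mpoly_eq0_char0 => // a.
  by rewrite tnth_mktuple enum_rankK mevalB mevalXU rhoS ?subrr.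
rewrite (eq_bigl (fun xi => xi \in ~: S)); last by move=> xi; rewrite inE.
rewrite big_enum_val /=; apply: eq_bigr => i _.
by rewrite tnth_mktuple enum_rankK.
Qed.

(** * The coadjoint action and the order on roots *)

Lemma UT_diag (K : fieldType) n (g : 'M[K]_n) (i : 'I_n) : UT g -> g i i = 1.
Proof. by case/andP=> _ /forallP/(_ i)/eqP. Qed.

Lemma UT_upper (K : fieldType) n (g : 'M[K]_n) (i j : 'I_n) :
  UT g -> (i < j)%N -> g i j = 0.
Proof. by case/andP=> /is_trig_mxP trg _; apply: trg. Qed.

Lemma UT_mul (K : fieldType) n (g h : 'M[K]_n) : UT g -> UT h -> UT (g *m h).
Proof.
move=> UTg UTh; apply/andP; split.
  apply/is_trig_mxP => i j lt_ij; rewrite mxE big1 // => k _.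
  have [lt_ik | le_ki] := ltnP i k; first by rewrite UT_upper ?mul0r.
  by rewrite (UT_upper UTh) ?mulr0 // (leq_ltn_trans le_ki).
apply/forallP => i; rewrite mxE (bigD1 i) //= !UT_diag // mulr1 big1 ?addr0 //.
move=> k; rewrite -val_eqE /= neq_ltn => /orP[lt_ki | lt_ik].
  by rewrite (UT_upper UTh) ?mulr0.
by rewrite (UT_upper UTg) ?mul0r.
Qed.

Lemma UT1 (K : fieldType) n : UT (1%:M : 'M[K]_n).
Proof.
apply/andP; split; last by apply/forallP => i; rewrite mxE eqxx.
by apply/is_trig_mxP => i j lt_ij; rewrite mxE -val_eqE ltn_eqF.
Qed.

Lemma UT_line (K : fieldType) n (g : 'M[K]_n) t :
  UT g -> UT (1%:M + t *: (g - 1%:M)).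
Proof.
move=> UTg; apply/andP; split.
  apply/is_trig_mxP => i j lt_ij; rewrite !mxE (UT_upper UTg) // -val_eqE ltn_eqF //.
  by rewrite subr0 mulr0 addr0.
by apply/forallP => i; rewrite !mxE UT_diag // eqxx subrr mulr0 addr0.
Qed.

Lemma invmx_UT (K : fieldType) n (g : 'M[K]_n) : UT g -> invmx g = \adj g.
Proof.
move=> UTg; rewrite /invmx UT_unit // det_trig; last by case/andP: UTg.
by rewrite big1 ?invr1 ?scale1r // => i _; apply: UT_diag.
Qed.

Lemma coAdM (K : fieldType) n (g1 g2 : 'M[K]_n) (f : ut_dual K n) :
  UT g1 -> UT g2 -> coAd (g1 *m g2) f = coAd g1 (coAd g2 f).
Proof.
move=> UTg1 UTg2; apply/lfunP => x; rewrite !coAdE; congr (f _).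
have [[U1 U2] U12] := (UT_unit UTg1, UT_unit UTg2, UT_unit (UT_mul UTg1 UTg2)).
have inv12 : invmx (g1 *m g2) = invmx g2 *m invmx g1.
  by rewrite -[RHS](mulmxK U12) !mulmxA mulmxKV // mulVmx // mul1mx.
apply: val_inj => /=; rewrite !val_Ad ?UT_inv ?UT_mul // !invmxK inv12.
by rewrite !mulmxA.
Qed.

Lemma coAd1 (K : fieldType) n (f : ut_dual K n) : coAd 1%:M f = f.
Proof.
apply/lfunP => x; rewrite coAdE; congr (f _); apply: val_inj => /=.
by rewrite val_Ad ?UT_inv ?UT1 // invmxK invmx1 mul1mx mulmx1.
Qed.

(** The conjugate of a matrix unit is the product of a column of the inverse of g
    by a row of g. *)
Lemma coAd_yvec (K : fieldType) n (g : 'M[K]_n) (h : ut_dual K n) xi : UT g ->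
  coAd g h (yvec K xi) = \sum_eta
    invmx g (iroot eta) (iroot xi) * g (jroot xi) (jroot eta) * h (yvec K eta).
Proof.
move=> UTg; rewrite coAdE -[Ad _ _]vsvalK ut_dualE ?subvsP //.
apply: eq_bigr => eta _; congr (_ * _); rewrite val_Ad ?UT_inv // invmxK yvecE.
rewrite mxE (bigD1 (jroot xi)) //= mxE (bigD1 (iroot xi)) //= mxE !eqxx mulr1.
rewrite !big1 ?addr0 // => [k /negbTE ne|k /negbTE ne]; last by rewrite mxE ne mulr0.
by rewrite mxE big1 ?mul0r // => l _; rewrite mxE ne andbF mulr0.
Qed.

Definition root_le n (xi eta : posroot n) :=
  (jroot eta <= jroot xi)%N && (iroot xi <= iroot eta)%N.

(** A strictly decreasing measure for [root_le]: the distance of the matrix unit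
    from the lower left corner. *)
Definition depth n (xi : posroot n) : nat := jroot xi + (n - iroot xi).

Lemma depth_lt n (xi eta : posroot n) :
  root_le xi eta -> eta != xi -> (depth eta < depth xi)%N.
Proof.
move=> /andP[le_j le_i] ne; rewrite /depth.
have [lt_ix lt_ie] := (ltn_ord (iroot xi), ltn_ord (iroot eta)).
have : ~~ ((jroot eta == jroot xi :> nat) && (iroot eta == iroot xi :> nat)).
  by apply: contra ne => /andP[/eqP/val_inj ej /eqP/val_inj ei]; apply/eqP/root_eq.
by move: le_j le_i lt_ix lt_ie; lia.
Qed.

(** The conjugate of y_xi is y_xi plus a combination of matrix units of larger
    roots, so the action changes the coordinate xi by an amount that depends only
    on the coordinates above xi. *)
Lemma coAd_shift (K : fieldType) n (g : 'M[K]_n) (h1 h2 : ut_dual K n) xi : UT g ->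
  (forall eta, root_le xi eta -> eta != xi -> h1 (yvec K eta) = h2 (yvec K eta)) ->
  coAd g h1 (yvec K xi) - h1 (yvec K xi) = coAd g h2 (yvec K xi) - h2 (yvec K xi).
Proof.
move=> UTg eqh.
have split_sum (h : ut_dual K n) : coAd g h (yvec K xi) - h (yvec K xi) =
    \sum_(eta | eta != xi) invmx g (iroot eta) (iroot xi) *
      g (jroot xi) (jroot eta) * h (yvec K eta).
  rewrite coAd_yvec // (bigD1 xi) //= !UT_diag ?UT_inv // !mul1r.
  by rewrite addrAC subrr add0r.
rewrite !split_sum; apply: eq_bigr => eta ne.
have [/eqh -> //|] := boolP (root_le xi eta).
rewrite negb_and -!ltnNge => /orP[lt | lt].
  by rewrite (UT_upper UTg lt) mulr0 !mul0r.
by rewrite (UT_upper (UT_inv UTg) lt) !mul0r.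
Qed.

Definition upclosed n (D : {set posroot n}) :=
  forall xi eta, xi \in D -> root_le xi eta -> eta \in D.

Definition agree (K : fieldType) n (D : {set posroot n}) (h1 h2 : ut_dual K n) :=
  {in D, forall xi, h1 (yvec K xi) = h2 (yvec K xi)}.

Lemma coAd_agree (K : fieldType) n (D : {set posroot n}) (g : 'M[K]_n)
    (h1 h2 : ut_dual K n) :
  upclosed D -> UT g -> agree D h1 h2 -> agree D (coAd g h1) (coAd g h2).
Proof.
move=> closedD UTg eqh xi xiD; have := @coAd_shift _ _ g h1 h2 xi UTg.
rewrite (eqh xi) // => /(_ _)/addIr; apply=> eta le_xi _.
by apply: eqh; apply: closedD le_xi.
Qed.

(** The coadjoint cocycle f(y_xi a - a y_xi), linear in a. *)
Definition comm_form (K : fieldType) n (f : ut_dual K n) (g : 'M[K]_n) xi : K :=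
  f (vsproj (ut K n) (ymx K xi *m g)) - f (vsproj (ut K n) (g *m ymx K xi)).

(** The form vanishes at the identity, so it is homogeneous along lines through 1. *)
Lemma comm_form_line (K : fieldType) n (f : ut_dual K n) (g : 'M[K]_n) t xi :
  comm_form f (1%:M + t *: (g - 1%:M)) xi = t * comm_form f g xi.
Proof.
pose phi x : K := f (vsproj (ut K n) x).
have phiP b x y : phi (x + b *: (y - x)) = phi x + b * (phi y - phi x).
  by rewrite /phi linearD linearZ linearB linearD linearZ linearB.
have lin : ymx K xi *m (1%:M + t *: (g - 1%:M)) =
    ymx K xi + t *: (ymx K xi *m g - ymx K xi).
  by rewrite mulmxDr -scalemxAr mulmxBr mulmx1.
have lin' : (1%:M + t *: (g - 1%:M)) *m ymx K xi =
    ymx K xi + t *: (g *m ymx K xi - ymx K xi).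
  by rewrite mulmxDl -scalemxAl mulmxBl mul1mx.
rewrite /comm_form -!/(phi _) lin lin' !phiP.
by move: (phi _) (phi _) (phi _) => u v w; ring.
Qed.

(** Evaluate u = coAd g f at g y_xi instead of y_xi: these differ by matrix units
    of larger roots, where u and f agree, and u(g y_xi) = f(y_xi g) is linear in
    g, while the definition of u(y_xi) involves the inverse of g. *)
Lemma coAd_comm_form (K : fieldType) n (f : ut_dual K n) (g : 'M[K]_n) xi : UT g ->
  (forall eta, root_le xi eta -> eta != xi ->
     coAd g f (yvec K eta) = f (yvec K eta)) ->
  coAd g f (yvec K xi) - f (yvec K xi) = comm_form f g xi.
Proof.
move=> UTg eqf; have [trg _] := andP UTg.
have gy_ut : g *m ymx K xi \in ut K n by rewrite trig_mul_ut ?ymx_ut.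
have yg_ut : ymx K xi *m g \in ut K n by rewrite ut_mul_trig ?ymx_ut.
have gyE i : (g *m ymx K xi) i (jroot xi) = g i (iroot xi).
  rewrite mxE (bigD1 (iroot xi)) //= mxE !eqxx mulr1 big1 ?addr0 // => k /negbTE ne.
  by rewrite mxE ne mulr0.
have gyE0 i j : j != jroot xi -> (g *m ymx K xi) i j = 0.
  by move/negbTE=> ne; rewrite mxE big1 // => k _; rewrite mxE ne andbF mulr0.
rewrite /comm_form; have <- : coAd g f (vsproj (ut K n) (g *m ymx K xi)) =
    f (vsproj (ut K n) (ymx K xi *m g)).
  rewrite coAdE; congr (f _); apply: val_inj => /=.
  by rewrite val_Ad ?UT_inv // invmxK !vsprojK // mulmxA mulVmx ?UT_unit // mul1mx.
have expand (u v : ut_dual K n) :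
    (u (vsproj (ut K n) (g *m ymx K xi)) : K) - v (vsproj (ut K n) (g *m ymx K xi)) =
    \sum_eta (g *m ymx K xi) (iroot eta) (jroot eta) *
      ((u (yvec K eta) : K) - v (yvec K eta)).
  by rewrite !ut_dualE // -sumrB; apply: eq_bigr => eta _; rewrite mulrBr.
apply/esym; apply: etrans (expand _ _) _.
rewrite (bigD1 xi) //= gyE UT_diag // mul1r big1 ?addr0 //.
move=> eta ne; have [ej | nej] := eqVneq (jroot eta) (jroot xi); last first.
  by rewrite gyE0 // mul0r.
rewrite ej gyE; have [lt | le] := ltnP (iroot eta) (iroot xi).
  by rewrite UT_upper // mul0r.
by rewrite eqf ?subrr ?mulr0 // /root_le ej leqnn.
Qed.

(** By [coAd_comm_form], the stabilizer is cut out by linear equations, which hold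
    on the line through 1 and g when they hold at g. *)
Lemma stabilizer_line (K : fieldType) n (f : ut_dual K n) (D : {set posroot n})
    (g : 'M[K]_n) t :
  upclosed D -> UT g -> agree D (coAd g f) f ->
  agree D (coAd (1%:M + t *: (g - 1%:M)) f) f.
Proof.
move=> closedD UTg stab xi; have [m] := ubnP (depth xi).
elim: m xi => // m IHm xi /ltnSE le_m xiD; apply/eqP; rewrite -subr_eq0.
rewrite coAd_comm_form ?UT_line // => [|eta le_xi ne].
  rewrite comm_form_line -coAd_comm_form // => [|eta le_xi _].
    by rewrite stab // subrr mulr0.
  by apply: stab; apply: closedD le_xi.
by apply: IHm; [apply: leq_trans (depth_lt le_xi ne) le_m | apply: closedD le_xi].
Qed.

(** * Polynomial sections of the orbit map *)

(** The adjugate stands for the inverse of s, since s takes unitriangular values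
    in the applications. *)
Definition coAd_mpoly (K : fieldType) n (f : ut_dual K n)
    (s : 'M[poly_dual K n]_n) (xi : posroot n) : poly_dual K n :=
  \sum_eta (\adj s) (iroot eta) (iroot xi) * s (jroot xi) (jroot eta) *
    (f (yvec K eta))%:MP.

Lemma coAd_mpolyE (K : fieldType) n (f : ut_dual K n) (s : 'M[poly_dual K n]_n) xi a :
  UT (map_mx (meval a) s) ->
  (coAd_mpoly f s xi).@[a] = coAd (map_mx (meval a) s) f (yvec K xi).
Proof.
move=> UTs; rewrite coAd_yvec // raddf_sum invmx_UT // -map_mx_adj.
by apply: eq_bigr => eta _ /=; rewrite !mevalM mevalC !mxE.
Qed.

(** The matrix s is a section of the orbit map over D: S consists of the free roots
    of D, and s(a) f realizes the values of a on S and is, on D, the only point of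
    the orbit with these values. *)
Lemma orbit_section (K : fieldType) n (f : ut_dual K n) (D : {set posroot n}) :
  upclosed D ->
  exists (S : {set posroot n}) (s : 'M[poly_dual K n]_n),
    [/\ S \subset D, forall a, UT (map_mx (meval a) s),
        forall a, {in S, forall xi,
          coAd (map_mx (meval a) s) f (yvec K xi) = a (enum_rank xi)} &
        forall (a : 'I_#|{: posroot n}| -> K) h, coAd_orbit f h ->
          {in S, forall xi, h (yvec K xi) = a (enum_rank xi)} ->
          agree D h (coAd (map_mx (meval a) s) f)].
Proof.
have [m] := ubnP #|D|; elim: m D => // m IHm D /ltnSE le_Dm closedD.
have [-> | [xi0 xi0D]] := set_0Vmem D.
  exists set0, 1%:M; split=> [|a|a xi|a h _ _ xi]; rewrite ?inE //.
  by rewrite map_mx1 UT1.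
case: (@arg_maxnP _ xi0 (mem D) (@depth n) xi0D) => xi xiD max_xi {xi0 xi0D}.
have {}xiD : xi \in D := xiD.
(* A root of D of maximal depth is minimal, so D1 is up-closed and contains all
   roots strictly above xi. *)
pose D1 := D :\ xi.
have above_xi eta : root_le xi eta -> eta != xi -> eta \in D1.
  by move=> le_xi ne; rewrite !inE ne /=; apply: closedD le_xi.
have closedD1 : upclosed D1.
  move=> z eta; rewrite !inE => /andP[ne zD] le_z; rewrite (closedD z) // andbT.
  apply: contraNneq ne => e; move: le_z; rewrite e => le_z.
  apply: contraTT (max_xi z zD) => ne; rewrite -ltnNge.
  by apply: depth_lt; rewrite // eq_sym.
have [||S [s [subS UTs sS sD]]] := IHm D1; rewrite // ?(leq_trans _ le_Dm) //.
  by rewrite [ltnRHS](cardsD1 xi) xiD.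
have agreeD h1 h2 : agree D1 h1 h2 -> h1 (yvec K xi) = h2 (yvec K xi) -> agree D h1 h2.
  by move=> eqh eq_xi z zD; have [-> //|ne] := eqVneq z xi; rewrite eqh // !inE ne.
(* Can the stabilizer of f on D1 move the coordinate xi? *)
have [[g [UTg stab nz_g]] | nog] := classic (exists g,
  [/\ UT g, agree D1 (coAd g f) f & comm_form f g xi != 0]); last first.
  exists S, s; split=> //.
    exact: subset_trans subS (subsetDl _ _).
  move=> a h orb_h eq_S; have eq_D1 := sD a h orb_h eq_S.
  apply: agreeD => //; case: orb_h => k UTk def_h; move: (UTs a) eq_D1.
  set ga := map_mx _ s => UTga eq_D1.
  (* h and ga f agree on D1, so the quotient of k by ga fixes f on D1, and then
     also at xi. *)
  pose k1 := invmx ga *m k; have UTk1 : UT k1 by rewrite UT_mul ?UT_inv.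
  have k1f : coAd k1 f = coAd (invmx ga) h by rewrite def_h coAdM // UT_inv.
  have gaK (h' : ut_dual K n) : coAd (invmx ga) (coAd ga h') = h'.
    by rewrite -coAdM ?UT_inv // mulVmx ?UT_unit // coAd1.
  have gaKV (h' : ut_dual K n) : coAd ga (coAd (invmx ga) h') = h'.
    by rewrite -coAdM ?UT_inv // mulmxV ?UT_unit // coAd1.
  have stab : agree D1 (coAd k1 f) f.
    by rewrite k1f -[X in agree _ _ X](gaK f); apply: coAd_agree; rewrite ?UT_inv.
  have stab_xi : coAd k1 f (yvec K xi) = f (yvec K xi).
    apply/eqP; rewrite -subr_eq0 coAd_comm_form // => [|eta le_xi ne].
      by apply: contra_notT nog => nz; exists k1.
    exact/stab/above_xi.
  have := @coAd_shift _ _ ga (coAd k1 f) f xi UTga.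
  rewrite stab_xi k1f gaKV => /(_ _)/addIr; apply=> eta le_xi ne.
  by rewrite -k1f; apply/stab/above_xi.
(* The element 1 + t c (g - 1) fixes f on D1 and translates its coordinate xi by
   t; s1 uses it to bring that coordinate of s(a) f to the value of a. *)
pose c := (comm_form f g xi)^-1.
pose T : poly_dual K n := 'X_(enum_rank xi) - coAd_mpoly f s xi.
pose B : 'M[poly_dual K n]_n := map_mx (@mpolyC _ K) (c *: (g - 1%:M)).
pose s1 := s *m (1%:M + T *: B).
pose t a := T.@[a] * c.
have s1E a : map_mx (meval a) s1 =
    map_mx (meval a) s *m (1%:M + t a *: (g - 1%:M)).
  rewrite map_mxM map_mxD map_mx1 map_mxZ -scalerA; congr (_ *m (_ + _ *: _)).
  by apply/matrixP => i j; rewrite !mxE; apply: mevalC.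
have UTh a : UT (1%:M + t a *: (g - 1%:M)) by apply: UT_line.
have s1f a : coAd (map_mx (meval a) s1) f =
    coAd (map_mx (meval a) s) (coAd (1%:M + t a *: (g - 1%:M)) f).
  by rewrite s1E coAdM.
have s1D a : agree D1 (coAd (map_mx (meval a) s1) f) (coAd (map_mx (meval a) s) f).
  by rewrite s1f; apply: coAd_agree => //; apply: stabilizer_line.
have s1xi a : coAd (map_mx (meval a) s1) f (yvec K xi) = a (enum_rank xi).
  have stab_a : agree D1 (coAd (1%:M + t a *: (g - 1%:M)) f) f.
    exact: stabilizer_line.
  have cancel_diff (x u v w b : K) : x - u = v - w -> u - w = b - v -> x = b.
    by move=> e1 e2; rewrite -[x](subrK u) e1 -[u](subrK w) e2; ring.
  have agree_above h : agree D1 h f -> forall eta, root_le xi eta -> eta != xi ->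
      h (yvec K eta) = f (yvec K eta).
    by move=> eqh eta le_xi ne; apply/eqh/above_xi.
  rewrite s1f; apply: cancel_diff (coAd_shift (UTs a) (agree_above _ stab_a)) _.
  rewrite [LHS](coAd_comm_form (UTh a) (agree_above _ stab_a)) comm_form_line.
  by rewrite mulfVK // mevalB mevalXU coAd_mpolyE.
exists (xi |: S), s1; split=> [|a | a z | a h orb_h eq_S].
- by rewrite subUset sub1set xiD (subset_trans subS) // subsetDl.
- by rewrite s1E UT_mul.
- rewrite !inE => /predU1P[-> // | zS].
  by rewrite s1D ?sS // (subsetP subS).
apply: agreeD => [z zD1|]; last by rewrite s1xi eq_S // setU11.
rewrite s1D // (sD a h) // => eta etaS.
by rewrite eq_S // setU1r.
Qed.

(** * Orbits are complete intersections *)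

Lemma complete_intersection_coAd_orbit (K : fieldType) n (f : ut_dual K n) :
  [pchar K] =i pred0 -> complete_intersection (coAd_orbit f).
Proof.
move=> charK0; have closedT : upclosed [set: posroot n] by move=> xi eta _ _; rewrite inE.
have [S [s [_ UTs sS sT]]] := orbit_section f closedT.
apply: (@retract_complete_intersection _ _ _ S (coAd_mpoly f s)) => // [a|xi xiS a|h a].
- exists (coAd (map_mx (meval a) s) f) => [|xi]; last by rewrite coAd_mpolyE.
  by exists (map_mx (meval a) s).
- by rewrite coAd_mpolyE // sS.
by move=> orb_h eq_S xi; rewrite coAd_mpolyE // (sT a h).
Qed.

Theorem corollary1p6 (K : fieldType) (charK0 : [pchar K]%R =i pred0)
    (n : nat) (sigma : 'S_n) (sigma_inv : (sigma * sigma = 1)%g)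
    (f : ut_dual K n) (fX : X sigma f) :
  complete_intersection (coAd_orbit f).
Proof. exact: complete_intersection_coAd_orbit. Qed.
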